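(* Let $W\in\mathcal{C}^1(\mathbb{R}^n,\mathbb{R}_{\ge0})$ be positive definite ($W(0)=0$ and $W(x)>0$ for $x\neq0$). 1. If $$\nabla W(x)^\top J_nx-\frac{q-1}{q}\left|\frac{\partial W}{\partial x_n}(x)\right|^{\frac{q}{q-1}}\le -F(x),\qquad\forall x\in\mathbb{R}^n,$$ then $V_\infty(x)\le W(x)$ for every $x\in\mathbb{R}^n$. 2. If $$\nabla W(x)^\top J_nx-\frac{q-1}{q}\left|\frac{\partial W}{\partial x_n}(x)\right|^{\frac{q}{q-1}}\ge -F(x),\qquad\forall x\in\mathbb{R}^n,$$ then $V_\infty(x)\ge W(x)$ for every $x\in\mathbb{R}^n$.
   Context: Let $n\ge 1$ be an integer and $q\in(1,\infty)$. $J_n$ is the $n\times n$ Jordan block with eigenvalue $0$ (ones on the superdiagonal, zeros elsewhere) and $e_n$ is the last canonical basis vector of $\mathbb{R}^n$. The control system is $\dot x=J_nx+e_nu$. The function $F:\mathbb{R}^n\to\mathbb{R}_{\ge 0}$ is continuously differentiable, convex and positive definite ($F(0)=0$, $F(x)>0$ for $x\ne0$). For $x_0\in\mathbb{R}^n$ and $u\in L^q(\mathbb{R}_{\ge0},\mathbb{R})$, $\mathcal{J}_\infty(x_0,u)=\int_0^\infty\left(\frac{|u(t)|^q}{q}+F(x(t))\right)dt$, where $x(\cdot)$ is the trajectory of the control system with $x(0)=x_0$ and control $u$; $V_\infty(x_0)=\inf_{u\in L^q(\mathbb{R}_{\ge0},\mathbb{R})}\mathcal{J}_\infty(x_0,u)$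 is the value function. *)

(* Defs.v *)
From HB Require Import structures.
From mathcomp Require Import all_boot all_order all_algebra.
From mathcomp Require Import all_classical all_reals all_analysis.

Set Implicit Arguments.
Unset Strict Implicit.
Unset Printing Implicit Defensive.

Import Order.TTheory GRing.Theory Num.Theory.
Import numFieldNormedType.Exports.

Local Open Scope classical_set_scope.
Local Open Scope ring_scope.

Definition jordan_block (R : realType) (n : nat) : 'M[R]_n :=
  \matrix_(i < n, j < n) ((j == i.+1 :> nat)%:R).

Definition e_last (R : realType) (n : nat) : 'cV[R]_n.+1 :=
  delta_mx ord_max 0.

Definition grad (R : realType) (n : nat) (W : 'cV[R]_n.+1 -> R)
    (x : 'cV[R]_n.+1) : 'cV[R]_n.+1 :=
  \col_i 'D_(delta_mx i 0) W x.

Definition class_C1 (R : realType) (n : nat) (W : 'cV[R]_n.+1 -> R) : Prop :=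
  (forall x, differentiable W x) /\ continuous (grad W).

Definition pos_def (R : realType) (n : nat) (W : 'cV[R]_n.+1 -> R) : Prop :=
  W 0 = 0 /\ forall x, x != 0 -> 0 < W x.

(* The space L^q([0, +oo[): controls are total functions, but only their values
   on [0, +oo[ matter. *)
Definition control (R : realType) (q : R) : set (R -> R) :=
  [set u : R -> R | patch (fun=> 0 : R) `[0, +oo[ u
                    \in Lfun (@lebesgue_measure R) q%:E].

(* Caratheodory solutions of x' = J x + u e_n on [0, +oo[ with x(0) = x0, in
   integral form; the integral of a vector is taken componentwise. *)
Definition is_trajectory (R : realType) (n : nat) (x0 : 'cV[R]_n.+1)
    (u : R -> R) (x : R -> 'cV[R]_n.+1) : Prop :=
  {within `[0, +oo[, continuous x} /\
  forall t : R, 0 <= t ->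
    x t = x0 + \col_i \int[lebesgue_measure]_(s in `[0, t])
                 (jordan_block R n.+1 *m x s + u s *: e_last R n) i 0.

(* For a locally integrable u a solution exists, and it is unique on [0, +oo[,
   so that the choice made by [xget] is immaterial there. *)
Definition trajectory (R : realType) (n : nat) (x0 : 'cV[R]_n.+1)
    (u : R -> R) : R -> 'cV[R]_n.+1 :=
  xget (fun=> 0) [set x | is_trajectory x0 u x].

Definition cost (R : realType) (n : nat) (q : R) (F : 'cV[R]_n.+1 -> R)
    (x0 : 'cV[R]_n.+1) (u : R -> R) : \bar R :=
  (\int[lebesgue_measure]_(t in `[0%R, +oo[)
     (`|u t| `^ q / q + F (trajectory x0 u t))%:E)%E.

Definition value (R : realType) (n : nat) (q : R) (F : 'cV[R]_n.+1 -> R)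
    (x0 : 'cV[R]_n.+1) : \bar R :=
  ereal_inf [set cost q F x0 u | u in control q].

(* Main.v *)
(* Along a trajectory, [W] changes at the rate
   [grad W . J x + (d_n W) u]; by Young's inequality this is at least
   [grad W . J x - (q-1)/q |d_n W|^(q/(q-1)) - |u|^q / q], with equality for the
   feedback [u = - sgn (d_n W) |d_n W|^(1/(q-1))].
   If the Hamilton-Jacobi expression is [>= -F], integration gives
   [W x0 <= W (x T) + cost on [0, T]], and a finite cost forces [F (x T)], hence
   [x T] by convexity, hence [W (x T)], to be small at some time [T].
   If it is [<= -F], the feedback would be optimal, but it is only continuous in
   [x]; instead of solving the closed-loop equation it is sampled, the control
   being held constant on short intervals.  The budget already spent bounds the
   [L^q] norm of the control and hence the state on bounded time intervals, which
   gives a step length that is uniform on each [[0, B]]; the process thus reaches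
   every time [B]. *)
Require Import Defs.
From HB Require Import structures.
From mathcomp Require Import all_boot all_order all_algebra.
From mathcomp Require Import all_classical all_reals all_analysis.
From mathcomp Require Import measurable_realfun ring lra.

Set Implicit Arguments.
Unset Strict Implicit.
Unset Printing Implicit Defensive.

Import Order.TTheory GRing.Theory Num.Theory.
Import numFieldNormedType.Exports.

Local Open Scope classical_set_scope.
Local Open Scope ring_scope.

(** * Sup norm, compact balls and uniform continuity *)

Lemma le_coord_mx_norm (R : realType) (m n : nat) (x : 'M[R]_(m, n)) i j :
  `|x i j| <= `|x|.
Proof.
rewrite [leRHS]/Num.norm/= mx_normrE.
by apply/bigmax_geP; right => /=; exists (i, j).
Qed.

Lemma mx_norm_le (R : realType) (m n : nat) (x : 'M[R]_(m, n)) (M : R) :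
  0 <= M -> (forall i j, `|x i j| <= M) -> `|x| <= M.
Proof.
move=> M0 xM; rewrite [leLHS]/Num.norm/= mx_normrE.
by apply/bigmax_leP; split => //= -[i j] _; exact: xM.
Qed.

Lemma trmx_norm (R : realType) (m n : nat) (x : 'M[R]_(m, n)) : `|x^T| = `|x|.
Proof.
apply/eqP; rewrite eq_le; apply/andP; split; apply: mx_norm_le => // i j.
  by rewrite mxE le_coord_mx_norm.
by have := le_coord_mx_norm x^T j i; rewrite mxE.
Qed.

Lemma isometry_continuous (R : realType) (U V : normedModType R) (f : U -> V) :
  (forall x y, `|f x - f y| = `|x - y|) -> continuous f.
Proof.
move=> fxy x; apply/cvgrPdist_lt => e e0; near=> y.
by rewrite fxy; near: y; exact: cvgr_dist_lt.
Unshelve. all: by end_near. Qed.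

(** Transposition is an isometry, so the set is the continuous image of a bounded closed set of row
    vectors, to which [bounded_closed_compact] applies. *)
Lemma cV_bounded_closed_compact (R : realType) (n : nat) (A : set 'cV[R]_n) :
  bounded_set A -> closed A -> compact A.
Proof.
move=> bA cA.
have ctr m p : continuous (@trmx R m p).
  by apply: isometry_continuous => x y; rewrite -linearB trmx_norm.
have -> : A = (@trmx R 1 n) @` ((@trmx R 1 n) @^-1` A).
  apply/seteqP; split => [x Ax|_ [y Ay <-]//].
  by exists x^T; rewrite /= trmxK.
apply: continuous_compact; first exact/continuous_subspaceT/ctr.
apply: bounded_closed_compact; last first.
  by have /continuous_closedP := ctr 1 n; exact.
case: bA => M [Mr AM]; exists M; split => // N MN x /= Ax.
by rewrite -trmx_norm; exact: AM.
Qed.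

Lemma cV_ball_compact (R : realType) (n : nat) (M : R) :
  compact [set y : 'cV[R]_n | `|y| <= M].
Proof.
apply: cV_bounded_closed_compact.
  by exists M; split; rewrite ?num_real// => N MN y /= yM; rewrite (le_trans yM)// ltW.
have -> : [set y : 'cV[R]_n | `|y| <= M] =
    (fun y : 'cV[R]_n => `|y|) @^-1` [set r | r <= M] by [].
by apply: preimage_closed => [y _|]; [exact: norm_continuous|exact: closed_le].
Qed.

(** Heine-Cantor theorem. The near-covering form of compactness turns the radii found at single
    points into one radius for all of [K]. *)
Lemma compact_unif_dist (R : realType) (U V : normedModType R) (f : U -> V)
    (K : set U) : compact K -> {within K, continuous f} ->
  forall e, 0 < e -> exists2 d, 0 < d &
    forall x y, K x -> K y -> `|x - y| < d -> `|f x - f y| < e.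
Proof.
move=> cK cf e e0.
pose P (d : R) (x : U) := K x -> forall y, K y -> `|x - y| < d -> `|f x - f y| < e.
have near_P : \forall d \near 0^'+, K `<=` P d.
  have /compact_near_coveringP := cK; apply => x Kx.
  have e20 : 0 < e / 2 by rewrite divr_gt0.
  have : \forall y \near within K (nbhs x), `|f x - f y| < e / 2.
    have /cvgrPdist_lt/(_ _ e20) := cf x.
    by rewrite nbhs_subspace_in.
  rewrite near_withinE => /nbhs_normP[d /= d0 dK].
  (* Halving [d] leaves room for two moves, from [x] to [y] and from [y] to [z]; both points stay
     within [d] of [x]. *)
  exists (ball x (d / 2), [set r | 0 < r < d / 2]); first split => /=.
  - by apply: nbhsx_ballx; rewrite divr_gt0.
  - near=> r; apply/andP; split; near: r; first exact: nbhs_right_gt.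
    by apply: nbhs_right_lt; rewrite divr_gt0.
  move=> [y r] /= []; rewrite -ball_normE /= => xy /andP[r0 rd] Ky z Kz yz.
  have fy : `|f x - f y| < e / 2 by apply: dK => //=; rewrite (lt_trans xy)//; lra.
  have fz : `|f x - f z| < e / 2.
    apply: dK => //=.
    have -> : x - z = (x - y) + (y - z) by rewrite addrA subrK.
    rewrite (le_lt_trans (ler_normD _ _))//; lra.
  have -> : f y - f z = (f x - f z) - (f x - f y) by rewrite opprB [RHS]addrC addrA subrK.
  rewrite (le_lt_trans (ler_normB _ _))//; lra.
near (0 : R)^'+ => d; exists d; first by near: d; exact: nbhs_right_gt.
have KP : K `<=` P d by near: d.
by move=> x y Kx; exact: KP.
Unshelve. all: by end_near. Qed.

(** * Integrals over segments and local integrability *)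

Local Notation mu := lebesgue_measure.

Lemma subset_itvcc (R : realType) (a b c d : R) :
  c <= a -> b <= d -> `[a, b] `<=` `[c, d].
Proof. by move=> ca bd; apply: subset_itv; rewrite bnd_simp. Qed.

Lemma subset_itvcy (R : realType) (a b : R) : 0 <= a -> `[a, b] `<=` `[0, +oo[.
Proof. by move=> a0; apply: subset_itv; rewrite bnd_simp. Qed.

Lemma Rintegral_chasles (R : realType) (f : R -> R) (a b c : R) :
  a <= b -> b <= c -> mu.-integrable `[a, c] (EFin \o f) ->
  \int[mu]_(t in `[a, c]) f t =
  \int[mu]_(t in `[a, b]) f t + \int[mu]_(t in `[b, c]) f t.
Proof.
move=> ab bc intf; apply/eqP; rewrite addrC -subr_eq; apply/eqP.
rewrite Rintegral_itvB ?bnd_simp// Rintegral_itv_obnd_cbnd//.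
apply: integrableS intf => //; apply: subset_itv; rewrite bnd_simp//.
Qed.

Lemma mu_itvcc (R : realType) (a b : R) : a <= b -> mu `[a, b] = (b - a)%:E.
Proof.
move=> ab; rewrite lebesgue_measure_itv/= lte_fin.
by case: ltP => [_//|ba]; rewrite (le_anti (introT andP (conj ab ba))) subrr.
Qed.

Lemma continuous_itv_integrable (R : realType) (f : R -> R) (a b : R) :
  {within `[a, b], continuous f} -> mu.-integrable `[a, b] (EFin \o f).
Proof. by apply: continuous_compact_integrable; exact: segment_compact. Qed.

Lemma cst_itv_integrable (R : realType) (a b c : R) :
  mu.-integrable `[a, b] (EFin \o cst c).
Proof. by apply: continuous_itv_integrable; exact: cst_continuous. Qed.

Lemma Rintegral_itv_cst (R : realType) (a b c : R) : a <= b ->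
  \int[mu]_(t in `[a, b]) (cst c t) = c * (b - a).
Proof.
move=> ab.
by rewrite Rintegral_cst//= -[b - a]/(fine (b - a)%:E) -mu_itvcc.
Qed.

Lemma Rintegral_le_cst (R : realType) (f : R -> R) (a b M : R) : a <= b ->
  mu.-integrable `[a, b] (EFin \o f) -> (forall t, a < t <= b -> f t <= M) ->
  \int[mu]_(t in `[a, b]) f t <= M * (b - a).
Proof.
move=> ab intf fM.
have intM := cst_itv_integrable a b M.
have <- := Rintegral_itv_cst M ab.
have sub : `]a, b] `<=` `[a, b] by exact: subset_itv_oc_cc.
have intf' : mu.-integrable `]a, b] (EFin \o f) by exact: integrableS intf.
have intM' : mu.-integrable `]a, b] (EFin \o cst M) by exact: integrableS intM.
rewrite -Rintegral_itv_obnd_cbnd// -[leRHS]Rintegral_itv_obnd_cbnd//.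
by apply: le_Rintegral => // t; rewrite /= in_itv; exact: fM.
Qed.

Definition loc_integrable (R : realType) (u : R -> R) :=
  forall t, mu.-integrable `[0, t] (EFin \o u).

Lemma loc_integrable_itv (R : realType) (u : R -> R) (a b : R) :
  loc_integrable u -> 0 <= a -> mu.-integrable `[a, b] (EFin \o u).
Proof.
by move=> uL a0; apply: integrableS (uL b) => //; exact: subset_itvcc.
Qed.

(** Near [t] the ray coincides with the segment [[0, t + 1]]. *)
Lemma within_ray_continuous (R : realType) (V : topologicalType) (f : R -> V) :
  (forall t, 0 <= t -> {within `[0, t], continuous f}) ->
  {within `[0, +oo[, continuous f}.
Proof.
move=> cf; apply/subspace_continuousP => t; rewrite /= in_itv/= andbT => t0.
have t10 : 0 <= t + 1 by rewrite addr_ge0.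
have /subspace_continuousP := cf _ t10.
move=> /(_ t); rewrite /= in_itv/= t0 lerDl ler01 => /(_ isT).
move=> h A /h hA.
suff : \forall s \near t, `[0, +oo[%classic s -> A (f s) by [].
have {}hA : \forall s \near t, `[0, t + 1]%classic s -> A (f s) by exact: hA.
have st1 : \forall s \near t, s < t + 1 by apply: lt_nbhsl; rewrite ltrDl.
apply: filterS2 hA st1 => s /= sA st.
rewrite in_itv/= andbT => s0; apply: sA.
by rewrite in_itv/= s0 ltW.
Qed.

Lemma primitive_continuous (R : realType) (u : R -> R) : loc_integrable u ->
  {within `[0, +oo[, continuous (fun t => \int[mu]_(s in `[0, t]) u s)}.
Proof.
move=> uL; apply: within_ray_continuous => t t0.
exact: parameterized_integral_continuous.
Qed.

Lemma continuous_loc_integrable (R : realType) (f : R -> R) :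
  {within `[0, +oo[, continuous f} -> loc_integrable f.
Proof.
move=> cf t; apply: continuous_itv_integrable.
by apply: continuous_subspaceW cf; exact: subset_itvcy.
Qed.

(** * Trajectories of the chain of integrators *)

(** The derivative of coordinate [i] is coordinate [i.+1], and that of the last one is the control;
    properties of trajectories are therefore proved downwards from [ord_max]. *)
Lemma ord_ind_down (n : nat) (P : 'I_n.+1 -> Prop) : P ord_max ->
  (forall (i : 'I_n.+1) (h : (i.+1 < n.+1)%N), P (Ordinal h) -> P i) ->
  forall i, P i.
Proof.
move=> Pmax PS i.
have [k] : exists k, (n - i = k)%N by exists (n - i)%N.
elim: k i => [|k IH] i ik.
  rewrite (_ : i = ord_max)//; apply: val_inj => /=.
  by apply/eqP; rewrite eqn_leq -ltnS ltn_ord/= -subn_eq0 ik.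
have h : (i.+1 < n.+1)%N by rewrite ltnS -subn_gt0 ik.
by apply: (PS i h); apply: IH => /=; rewrite subnS ik.
Qed.

Definition velocity (R : realType) (n : nat) (u : R -> R) (x : R -> 'cV[R]_n.+1)
  (s : R) : 'cV[R]_n.+1 := jordan_block R n.+1 *m x s + u s *: e_last R n.

Lemma velocity_lt (R : realType) (n : nat) (u : R -> R) (x : R -> 'cV[R]_n.+1)
    (i : 'I_n.+1) (h : (i.+1 < n.+1)%N) s :
  velocity u x s i 0 = x s (Ordinal h) 0.
Proof.
rewrite !mxE (bigD1 (Ordinal h))//= big1 ?addr0.
  rewrite !mxE/= eqxx mul1r (_ : i == ord_max = false) ?mulr0 ?addr0//.
  by apply/eqP => /(congr1 val)/= ihn; move: h; rewrite ihn ltnn.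
move=> j jh; rewrite !mxE (_ : (j == i.+1 :> nat) = false) ?mul0r//.
by apply/negP => /eqP ji; move/eqP: jh; apply; exact: val_inj.
Qed.

Lemma velocity_max (R : realType) (n : nat) (u : R -> R) (x : R -> 'cV[R]_n.+1) s :
  velocity u x s ord_max 0 = u s.
Proof.
rewrite !mxE big1 ?add0r ?eqxx ?mulr1// => j _.
by rewrite !mxE (_ : (j == _ :> nat) = false) ?mul0r// ltn_eqF.
Qed.

Lemma trajectory_coord (R : realType) (n : nat) x0 u (x : R -> 'cV[R]_n.+1) t i :
  is_trajectory x0 u x -> 0 <= t ->
  x t i 0 = x0 i 0 + \int[mu]_(s in `[0, t]) velocity u x s i 0.
Proof. by move=> [_ xE] t0; rewrite [in LHS]xE// !mxE. Qed.

Lemma trajectory_coord_continuous (R : realType) (n : nat) x0 u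
    (x : R -> 'cV[R]_n.+1) i : is_trajectory x0 u x ->
  {within `[0, +oo[, continuous (fun t => x t i 0)}.
Proof.
move=> [cx _] t; apply: (@continuous_comp _ _ _ (x : subspace _ -> _)
  (fun M : 'cV[R]_n.+1 => M i 0)); first exact: cx.
exact: coord_continuous.
Qed.

Lemma velocity_loc_integrable (R : realType) (n : nat) x0 u
    (x : R -> 'cV[R]_n.+1) i : is_trajectory x0 u x -> loc_integrable u ->
  loc_integrable (fun s => velocity u x s i 0).
Proof.
move=> xu uL; have [h|h] := ltnP i.+1 n.+1.
  under eq_fun do rewrite (velocity_lt _ _ h).
  by apply: continuous_loc_integrable; exact: trajectory_coord_continuous xu.
have -> : i = ord_max.
  by apply: val_inj => /=; apply/eqP; rewrite eqn_leq -ltnS ltn_ord.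
by under eq_fun do rewrite velocity_max.
Qed.

(** Equal controls give equal last coordinates, and equality passes by integration from each
    coordinate to the one before it. For [u = v] this is uniqueness of the solution. *)
Lemma trajectory_causal (R : realType) (n : nat) x0 u v
    (x y : R -> 'cV[R]_n.+1) T : is_trajectory x0 u x -> is_trajectory x0 v y ->
  (forall s, 0 <= s <= T -> u s = v s) -> forall t, 0 <= t <= T -> x t = y t.
Proof.
move=> xu yv uv t tT; apply/matrixP => i j; rewrite ord1 {j}.
elim/ord_ind_down : i t tT => [|i h IH] t /andP[t0 tT].
  rewrite (trajectory_coord _ xu)// (trajectory_coord _ yv)//.
  congr (_ + _); apply: eq_Rintegral => s; rewrite inE/= in_itv/= => /andP[s0 st].
  by rewrite !velocity_max uv// s0 (le_trans st).
rewrite (trajectory_coord _ xu)// (trajectory_coord _ yv)//.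
congr (_ + _); apply: eq_Rintegral => s; rewrite inE/= in_itv/= => /andP[s0 st].
by rewrite !(velocity_lt _ _ h) IH// s0 (le_trans st).
Qed.

(** The index counts from the end: [k] stands for coordinate [n - k], obtained from the control by
    [k + 1] integrations. [inord] makes the definition total in [k]. *)
Fixpoint iter_primitive (R : realType) (n : nat) (x0 : 'cV[R]_n.+1) (u : R -> R)
    (k : nat) : R -> R := fun t => x0 (inord (n - k)) 0 +
  \int[mu]_(s in `[0, t])
    (if k is k'.+1 then iter_primitive x0 u k' s else u s).

Lemma iter_primitive_continuous (R : realType) (n : nat) (x0 : 'cV[R]_n.+1) u k :
  loc_integrable u -> {within `[0, +oo[, continuous (iter_primitive x0 u k)}.
Proof.
have step g c : loc_integrable g ->
    {within `[0, +oo[, continuous (fun t => c + \int[mu]_(s in `[0, t]) g s)}.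
  by move=> gL t; apply: cvgD; [exact: cvg_cst|exact: primitive_continuous].
move=> uL; elim: k => [|k IH]; apply: step => //.
exact: continuous_loc_integrable.
Qed.

Lemma mx_continuous (R : realType) (T : topologicalType) (m n : nat)
    (f : T -> 'M[R]_(m, n)) :
  (forall i j, continuous (fun t => f t i j)) -> continuous f.
Proof.
move=> cf t A [P nP PA].
suff : \forall s \near t, forall i j, P i j (f s i j).
  by apply: filterS => s; exact: PA.
by apply: filter_forall => i; apply: filter_forall => j; exact/cf/nP.
Qed.

Lemma trajectory_exists (R : realType) (n : nat) (x0 : 'cV[R]_n.+1) u :
  loc_integrable u -> exists x, is_trajectory x0 u x.
Proof.
move=> uL; pose x t : 'cV[R]_n.+1 := \col_i iter_primitive x0 u (n - i) t.
exists x; split.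
  apply: mx_continuous => i j.
  apply: subspace_eq_continuous (@iter_primitive_continuous _ _ x0 _ (n - i) uL).
  by move=> t _; rewrite /from_subspace mxE.
move=> t t0; apply/matrixP => i j; rewrite ord1 {j} !mxE.
have -> : x0 i 0 = x0 (inord (n - (n - i))) 0.
  by rewrite subKn ?inord_val// -ltnS ltn_ord.
under eq_Rintegral do rewrite -/(velocity u x _).
have [h|h] := ltnP i.+1 n.+1.
  under eq_Rintegral do rewrite (velocity_lt _ _ h) mxE/=.
  by move: h; rewrite ltnS => h; rewrite -(subnSK h).
have -> : i = ord_max.
  by apply: val_inj => /=; apply/eqP; rewrite eqn_leq -ltnS ltn_ord.
under eq_Rintegral do rewrite velocity_max.
by rewrite /= subnn.
Qed.

Lemma trajectoryP (R : realType) (n : nat) (x0 : 'cV[R]_n.+1) u :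
  loc_integrable u -> is_trajectory x0 u (trajectory x0 u).
Proof. by move=> uL; exact: (xgetPex _ (trajectory_exists x0 uL)). Qed.

(** Each integration over [[0, T]] costs at most a factor [1 + T], and coordinate [i] is [n - i]
    integrations away from the last one, which [|x0| + A] bounds. *)
Lemma trajectory_coord_bound (R : realType) (n : nat) x0 u
    (x : R -> 'cV[R]_n.+1) (A T : R) : is_trajectory x0 u x ->
  loc_integrable u -> \int[mu]_(s in `[0, T]) `|u s| <= A ->
  forall i t, 0 <= t <= T ->
    `|x t i 0| <= (`|x0| + A) * (1 + T) ^+ (n - i)%N.
Proof.
move=> xu uL uA; elim/ord_ind_down => [|i h IH] t /andP[t0 tT].
  rewrite (trajectory_coord _ xu)//= subnn expr0 mulr1.
  rewrite (le_trans (ler_normD _ _))// lerD ?le_coord_mx_norm//.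
  under eq_Rintegral do rewrite velocity_max.
  rewrite (le_trans (le_normr_Rintegral _ _))//.
  apply: le_trans uA; rewrite (Rintegral_chasles t0 tT).
    by rewrite lerDl Rintegral_ge0.
  exact: integrable_norm.
have T0 : 0 <= T by exact: le_trans tT.
have A0 : 0 <= A by apply: le_trans uA; exact: Rintegral_ge0.
have hi : (n - i)%N = (n - i.+1)%N.+1 by rewrite subnSK// -ltnS.
set B := (`|x0| + A) * (1 + T) ^+ (n - i.+1).
have B0 : 0 <= B by rewrite mulr_ge0 ?addr_ge0// exprn_ge0// addr_ge0.
have x0B : `|x0| <= B.
  rewrite (@le_trans _ _ ((`|x0| + A) * 1))//; first by rewrite mulr1 lerDl.
  by rewrite ler_wpM2l ?addr_ge0// exprn_ege1// lerDl.
rewrite (trajectory_coord _ xu)// hi exprS mulrCA -/B.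
rewrite (le_trans (ler_normD _ _))//.
rewrite mulrDl mul1r lerD//; first by rewrite (le_trans (le_coord_mx_norm _ _ _)).
have vL := velocity_loc_integrable i xu uL.
rewrite (le_trans (le_normr_Rintegral _ _))//.
rewrite (@le_trans _ _ (B * (t - 0)))//; last first.
  by rewrite subr0 mulrC ler_wpM2r.
apply: Rintegral_le_cst => //; first exact: integrable_norm.
move=> s /andP[s0 st]; rewrite (velocity_lt _ _ h); apply: IH.
by rewrite ltW// (le_trans st).
Qed.

Lemma trajectory_bound (R : realType) (n : nat) x0 u
    (x : R -> 'cV[R]_n.+1) (A T : R) : is_trajectory x0 u x ->
  loc_integrable u -> \int[mu]_(s in `[0, T]) `|u s| <= A ->
  forall t, 0 <= t <= T -> `|x t| <= (`|x0| + A) * (1 + T) ^+ n.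
Proof.
move=> xu uL uA t /andP[t0 tT].
have T0 : 0 <= T by exact: le_trans tT.
have A0 : 0 <= A by apply: le_trans uA; exact: Rintegral_ge0.
apply: mx_norm_le => [|i j].
  by rewrite mulr_ge0 ?addr_ge0// exprn_ge0// addr_ge0.
rewrite ord1 (le_trans (trajectory_coord_bound xu uL uA _ _))//; first by rewrite t0.
by rewrite ler_wpM2l ?addr_ge0// ler_weXn2l ?lerDl// leq_subr.
Qed.

Lemma trajectory_increment (R : realType) (n : nat) x0 u
    (x : R -> 'cV[R]_n.+1) s t i : is_trajectory x0 u x -> loc_integrable u ->
  0 <= s -> s <= t ->
  x t i 0 - x s i 0 = \int[mu]_(r in `[s, t]) velocity u x r i 0.
Proof.
move=> xu uL s0 st; have t0 := le_trans s0 st.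
rewrite !(trajectory_coord _ xu)//.
have vL := velocity_loc_integrable i xu uL.
rewrite (Rintegral_chasles s0 st (vL t)).
by rewrite opprD addrACA subrr add0r addrAC subrr add0r.
Qed.

(** * Chain rule along paths with integrable velocity *)

Lemma derive_grad (R : realType) (n : nat) (W : 'cV[R]_n.+1 -> R) x v :
  differentiable W x -> 'D_v W x = \sum_i grad W x i 0 * v i 0.
Proof.
move=> dW; rewrite deriveE// [in LHS](matrix_sum_delta v) linear_sum/=.
apply: eq_bigr => i _; rewrite big_ord1 linearZ/= mxE deriveE//.
by rewrite mulrC.
Qed.

Lemma mean_value_segment (R : realType) (n : nat) (W : 'cV[R]_n.+1 -> R) a b :
  (forall x, differentiable W x) -> exists2 th, 0 <= th <= 1 &
    W b - W a = \sum_i grad W (a + th *: (b - a)) i 0 * (b - a) i 0.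
Proof.
move=> dW; pose f (t : R) : R := W (a + t *: (b - a)).
(* The difference quotients of [f] are exactly those of [W] in the direction [b - a], so the
   derivative of [f] is a directional derivative of [W]. *)
have fE t : (fun h : R => h^-1 *: ((f \o shift t) (h *: (1 : R)) - f t)) =
    (fun h : R => h^-1 *: ((W \o shift (a + t *: (b - a))) (h *: (b - a)) -
       W (a + t *: (b - a)))).
  apply/funext => h; rewrite /f /= ; congr (_ *: (W _ - _)).
  by rewrite scaler1 scalerDl addrCA.
have df (t : R) : is_derive t (1 : R) f ('D_(b - a) W (a + t *: (b - a))).
  have dWt : derivable W (a + t *: (b - a)) (b - a) by exact: diff_derivable.
  split; first by rewrite /derivable fE.
  by rewrite /derive fE.
have cf : {within `[0, 1], continuous f}.
  apply: derivable_within_continuous => t _; exact: (@ex_derive _ _ _ _ _ _ _ (df t)).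
have [th th01 fth] := MVT_segment ler01 (fun t _ => df t) cf.
exists th; first by move: th01; rewrite in_itv.
rewrite -derive_grad//; move: fth.
by rewrite subr0 mulr1 /f scale1r scale0r addr0 [a + (b - a)]addrC subrK.
Qed.

(** By the triangle inequality the local bounds add up along a subdivision of [[a, b]] with mesh
    [d / 2]; the induction is on the number of pieces. *)
Lemma additive_local_bound (R : realType) (D H : R -> R -> R) (a b d : R) :
  0 < d ->
  (forall r s t, a <= r -> r <= s -> s <= t -> t <= b ->
     D r t = D r s + D s t /\ H r t = H r s + H s t) ->
  (forall s t, a <= s -> s <= t -> t <= b -> t - s < d -> `|D s t| <= H s t) ->
  a <= b -> `|D a b| <= H a b.
Proof.
move=> d0 DH loc ab.
have d20 : 0 < d / 2 by rewrite divr_gt0.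
suff main N : forall t, a <= t -> t <= b -> t - a <= (d / 2) *+ N -> `|D a t| <= H a t.
  have [N bN] : exists N, (b - a) / (d / 2) < N%:R.
    exists (Num.bound ((b - a) / (d / 2))).
    by apply: archi_boundP; rewrite divr_ge0 ?subr_ge0// ltW.
  apply: (main N) => //.
  by move: bN; rewrite ltr_pdivrMr// mulr_natl => /ltW.
elim: N => [|N IH] t at_ tb.
  by rewrite mulr0n => ta; apply: loc => //; apply: le_lt_trans d0.
rewrite mulrS => ta.
(* [m] splits off the last piece; the maximum keeps it inside [[a, t]], and [d / 2] keeps its length
   strictly below [d]. *)
pose m := Num.max a (t - d / 2).
have am : a <= m by rewrite le_max lexx.
have mt : m <= t by rewrite ge_max at_/= lerBlDr lerDl ltW.
have tm : t - m < d.
  rewrite ltrBlDr -ltrBlDl (@lt_le_trans _ _ (t - d / 2))//; first lra.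
  by rewrite le_max lexx orbT.
have ma : m - a <= (d / 2) *+ N.
  rewrite lerBlDr ge_max; apply/andP; split; last by lra.
  by rewrite lerDr mulrn_wge0// ltW.
have [-> ->] := DH a m t (lexx _) am mt tb.
rewrite (le_trans (ler_normD _ _))// lerD//.
  by apply: IH => //; exact: le_trans mt tb.
exact: loc.
Qed.

Lemma integrable_continuousM (R : realType) (f g : R -> R) (a b : R) :
  {within `[a, b], continuous f} -> mu.-integrable `[a, b] (EFin \o g) ->
  mu.-integrable `[a, b] (EFin \o (f \* g)).
Proof.
move=> cf ig.
have -> : EFin \o (f \* g) = ((EFin \o f) \* (EFin \o g))%E.
  by apply/funext => t /=; rewrite EFinM.
apply: integrableMr => //.
  exact: subspace_continuous_measurable_fun.
have /compact_bounded[M [_ fM]] := continuous_compact cf (@segment_compact _ a b).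
by exists M; split; rewrite ?num_real// => N MN t ?; exact: fM.
Qed.

Lemma comp_within_continuous (T U V : topologicalType)
    (A : set T) (f : T -> U) (g : U -> V) :
  {within A, continuous f} -> continuous g -> {within A, continuous (g \o f)}.
Proof.
move=> cf cg t.
by apply: (@continuous_comp _ _ _ (f : subspace A -> _) g); [exact: cf|exact: cg].
Qed.

(** Balls are convex; this keeps the intermediate point of the mean value theorem close to the
    path. *)
Lemma segment_dist (R : realType) (V : normedModType R) (x y z : V) (th d : R) :
  0 <= th <= 1 -> `|x - z| < d -> `|y - z| < d -> `|x + th *: (y - x) - z| < d.
Proof.
move=> /andP[th0 th1] xd yd.
have -> : x + th *: (y - x) - z = (1 - th) *: (x - z) + th *: (y - z).
  rewrite scalerBl scale1r -[RHS]addrA [- (th *: _) + _]addrC -scalerBr opprB.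
  by rewrite addrA subrK addrAC.
rewrite (le_lt_trans (ler_normD _ _))// !normrZ (ger0_norm th0).
rewrite ger0_norm ?subr_ge0//.
have [->|th_neq0] := eqVneq th 0; first by rewrite subr0 mul1r mul0r addr0.
have th_gt0 : 0 < th by rewrite lt_neqAle eq_sym th_neq0.
rewrite [ltRHS](_ : d = (1 - th) * d + th * d); last by ring.
by rewrite ler_ltD ?ltr_pM2l// ler_wpM2l ?subr_ge0// ltW.
Qed.

(* Only integrability of the velocity is assumed, so [W \o x] need not be
   differentiable; on short intervals the defect of the formula is at most
   [e] times the length of the path, and both are additive. *)
Lemma chain_rule_integral (R : realType) (n : nat) (W : 'cV[R]_n.+1 -> R)
    (x p : R -> 'cV[R]_n.+1) (a b : R) : class_C1 W -> a <= b ->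
  {within `[a, b], continuous x} ->
  (forall i, mu.-integrable `[a, b] (fun r => (p r i 0)%:E)) ->
  (forall s t i, a <= s -> s <= t -> t <= b ->
    x t i 0 - x s i 0 = \int[mu]_(r in `[s, t]) p r i 0) ->
  mu.-integrable `[a, b] (EFin \o (fun r => \sum_i grad W (x r) i 0 * p r i 0)) /\
  W (x b) - W (x a) =
    \int[mu]_(r in `[a, b]) (\sum_i grad W (x r) i 0 * p r i 0).
Proof.
move=> [dW cW] ab cx ip xp.
have igp i : mu.-integrable `[a, b] (EFin \o (fun r => grad W (x r) i 0 * p r i 0)).
  apply: integrable_continuousM; last exact: ip.
  apply: (@comp_within_continuous _ _ _ _ x (fun y => grad W y i 0)) => //.
  move=> y; apply: (@continuous_comp _ _ _ (grad W) (fun M => M i 0)); first exact: cW.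
  exact: coord_continuous.
have Rint_sum (f : 'I_n.+1 -> R -> R) s t : a <= s -> t <= b ->
    (forall i, mu.-integrable `[a, b] (EFin \o f i)) ->
    mu.-integrable `[s, t] (EFin \o (fun r => \sum_i f i r)) /\
    \int[mu]_(r in `[s, t]) (\sum_i f i r) = \sum_i \int[mu]_(r in `[s, t]) f i r.
  move=> as_ tb fi; have {}fi i : mu.-integrable `[s, t] (EFin \o f i).
    by apply: integrableS (fi i) => //; exact: subset_itvcc.
  have fE : EFin \o (fun r => \sum_i f i r) = (fun r => \sum_i (f i r)%:E)%E.
    by apply/funext => r; rewrite /= sumEFin.
  split; first by rewrite fE; apply: integrable_sum => // i _; exact: fi.
  rewrite /Rintegral; under eq_integral do rewrite -sumEFin.
  rewrite integral_sum// sum_fine// => i _.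
  exact: integrable_fin_num (fi i).
set phi := fun r => \sum_i _.
have [iphi _] := Rint_sum _ _ _ (lexx a) (lexx b) igp.
split => //.
pose psi r : R := \sum_i `|p r i 0|.
have [ipsi _] := Rint_sum (fun i r => `|p r i 0|) _ _ (lexx a) (lexx b)
  (fun i => integrable_norm (ip i)).
pose D s t := W (x t) - W (x s) - \int[mu]_(r in `[s, t]) phi r.
(* A defect bounded by [e * L] for every [e > 0] is zero, [L] being the integral of [psi]; dividing
   by [L + 1] covers the case [L = 0]. *)
suff De e : 0 < e -> `|D a b| <= e * \int[mu]_(r in `[a, b]) psi r.
  apply/eqP; rewrite -subr_eq0 -normr_le0; apply/ler_addgt0Pr => e e0.
  have psi0 : 0 <= \int[mu]_(r in `[a, b]) psi r.
    by apply: Rintegral_ge0 => r _; apply: sumr_ge0.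
  set L := Rintegral _ _ _ in De psi0.
  have L1 : 0 < L + 1 by rewrite ltr_pwDr.
  rewrite add0r (le_trans (De (e / (L + 1)) _)) ?divr_gt0//.
  by rewrite mulrAC ler_pdivrMr//; apply: ler_wpM2l; [exact: ltW|rewrite lerDl].
move=> e0.
have sub s t : a <= s -> t <= b -> `[s, t] `<=` `[a, b].
  by move=> ? ?; exact: subset_itvcc.
pose H s t := e * \int[mu]_(r in `[s, t]) psi r.
(* The ball of radius [M] contains the path and, being convex, the intermediate points between any
   two of its positions; [grad W] is uniformly continuous there. *)
have [M Mx] : exists M, forall t, a <= t <= b -> `|x t| < M.
  have /compact_bounded[M [_ fM]] := continuous_compact cx (@segment_compact _ a b).
  exists (M + 2) => t tab; rewrite (@le_lt_trans _ _ (M + 1)) ?ltrD2l ?ltr1n//.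
  by apply: (fM (M + 1)); [rewrite ltrDl|exists t].
have [eta eta0 We] := compact_unif_dist (@cV_ball_compact R n.+1 M)
  (continuous_subspaceT cW) e0.
have [d d0 xd] := compact_unif_dist (@segment_compact _ a b) cx eta0.
apply: (@additive_local_bound _ D H a b d) => // [r s t ar rs st tb|s t as_ st tb tsd].
  have sub' : `[r, t] `<=` `[a, b] by exact: sub.
  rewrite /D /H (Rintegral_chasles rs st); last exact: integrableS iphi.
  rewrite (@Rintegral_chasles _ psi _ _ _ rs st); last exact: integrableS ipsi.
  by split; [ring|rewrite mulrDr].
have [th th01 Wth] := mean_value_segment (x s) (x t) dW.
set xi := x s + _ in Wth.
have ixip i : mu.-integrable `[a, b] (EFin \o (fun r => grad W xi i 0 * p r i 0)).
  by apply: integrable_continuousM; [exact: cst_continuous|exact: ip].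
have [ixi xiE] := Rint_sum _ s t as_ tb ixip.
have -> : D s t = \int[mu]_(r in `[s, t])
    (\sum_i grad W xi i 0 * p r i 0 - phi r).
  rewrite RintegralB//; last by apply: integrableS iphi => //; exact: sub.
  rewrite /D Wth xiE; congr (_ - _); apply: eq_bigr => i _.
  rewrite RintegralZl// ?mxE ?xp//; last by apply: integrableS (ip i) => //; exact: sub.
have sab := sub s t as_ tb.
have istphi : mu.-integrable `[s, t] (EFin \o phi).
  by apply: integrableS iphi.
have istpsi : mu.-integrable `[s, t] (EFin \o psi).
  by apply: integrableS ipsi.
have iepsi : mu.-integrable `[s, t] (EFin \o (fun r => e * psi r)).
  exact: (integrableZl _ e istpsi).
have idiff : mu.-integrable `[s, t]
    (EFin \o (fun r => \sum_i grad W xi i 0 * p r i 0 - phi r)).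
  exact: (integrableB _ ixi istphi).
rewrite /H -RintegralZl//.
apply: (le_trans (le_normr_Rintegral _ _)) => //.
apply: le_Rintegral => //; first exact: integrable_norm.
move=> r /=; rewrite in_itv/= => /andP[sr rt].
rewrite /phi /psi -sumrB mulr_sumr (le_trans (ler_norm_sum _ _ _))//.
apply: ler_sum => i _; rewrite -mulrBl normrM ler_wpM2r//.
have ar := le_trans as_ sr; have rb := le_trans rt tb.
have at_ := le_trans as_ st; have sb := le_trans st tb.
have xi_r : `|xi - x r| < eta.
  apply: segment_dist => //; apply: xd; rewrite /= ?in_itv/= ?as_ ?sb ?ar ?rb ?at_ ?tb//.
    by rewrite distrC ger0_norm ?subr_ge0// (le_lt_trans _ tsd)// lerD2r.
  by rewrite ger0_norm ?subr_ge0// (le_lt_trans _ tsd)// lerD2l lerN2.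
have xi_M : `|xi| < M.
  by rewrite -[xi]subr0; apply: segment_dist => //; rewrite subr0 Mx// ?as_ ?at_.
have /ltW := We _ _ (ltW xi_M) (ltW (Mx r (introT andP (conj ar rb)))) xi_r.
by apply: le_trans; have := le_coord_mx_norm (grad W xi - grad W (x r)) i 0; rewrite !mxE.
Qed.

(** The derivative of [W] in the direction [J x + u e_n]. *)
Definition power (R : realType) (n : nat) (W : 'cV[R]_n.+1 -> R) (u : R)
  (x : 'cV[R]_n.+1) : R :=
  ((grad W x)^T *m (jordan_block R n.+1 *m x)) 0 0 + grad W x ord_max 0 * u.

Lemma power_velocity (R : realType) (n : nat) (W : 'cV[R]_n.+1 -> R) u
    (x : R -> 'cV[R]_n.+1) t :
  \sum_i grad W (x t) i 0 * velocity u x t i 0 = power W (u t) (x t).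
Proof.
rewrite /power [X in _ = X + _]mxE.
under eq_bigr do rewrite /velocity [X in _ * X]mxE mulrDr.
rewrite big_split/=; congr (_ + _).
  by apply: eq_bigr => i _; rewrite [in RHS]mxE.
rewrite (bigD1 ord_max)//= big1 ?addr0.
  by rewrite !mxE !eqxx mulr1.
by move=> i im; rewrite !mxE (negbTE im) !mulr0.
Qed.

Lemma trajectory_chain_rule (R : realType) (n : nat) (W : 'cV[R]_n.+1 -> R) x0 u
    (x : R -> 'cV[R]_n.+1) (a b : R) : class_C1 W -> is_trajectory x0 u x ->
  loc_integrable u -> 0 <= a -> a <= b ->
  mu.-integrable `[a, b] (EFin \o (fun t => power W (u t) (x t))) /\
  W (x b) - W (x a) = \int[mu]_(t in `[a, b]) power W (u t) (x t).
Proof.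
move=> W1 xu uL a0 ab.
have -> : (fun t => power W (u t) (x t)) =
    (fun t => \sum_i grad W (x t) i 0 * velocity u x t i 0).
  by apply/funext => t; rewrite power_velocity.
apply: chain_rule_integral => //.
- by have [cx _] := xu; apply: continuous_subspaceW cx; exact: subset_itvcy.
- move=> i; apply: loc_integrable_itv => //.
  exact: velocity_loc_integrable xu uL.
- move=> s t i as_ st _; apply: (trajectory_increment _ xu uL) => //.
  exact: le_trans as_.
Qed.

(** * Controls in [L^q] and the running cost *)

(** Extension by zero leaves the integral unchanged because [0] to the power [q] is [0], and the
    outer power [q^-1] in the norm does not affect finiteness. *)
Lemma controlP (R : realType) (q : R) (u : R -> R) : 1 < q ->
  control q u <-> mu.-integrable `[0, +oo[ (fun t => (`|u t| `^ q)%:E) /\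
                  measurable_fun `[(0 : R), +oo[ u.
Proof.
move=> q1; have q0 : q != 0 by rewrite gt_eqF// (lt_trans ltr01).
set v := patch (fun=> 0 : R) `[0, +oo[ u.
have mv : measurable_fun setT v <-> measurable_fun `[(0 : R), +oo[ u.
  by symmetry; apply: (measurable_restrictT u); exact: measurable_itv.
have vN : finite_norm mu q%:E v <->
    (\int[mu]_(t in `[0%R, +oo[) (`|u t| `^ q)%:E < +oo)%E.
  rewrite /finite_norm unlock.
  have -> : (\int[mu]_t (`|(EFin \o v) t| `^ q) =
      \int[mu]_(t in `[0%R, +oo[) (`|u t| `^ q)%:E)%E.
    rewrite [RHS]integral_mkcond; apply: eq_integral => t _.
    rewrite /v patchE /= patchE; case: ifPn => //= _.
    by rewrite normr0 powR0.
  split; last exact: poweR_lty.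
  by apply: lty_poweRy; rewrite invr_eq0.
have muq : measurable_fun `[(0 : R), +oo[ u ->
    measurable_fun `[(0 : R), +oo[ (fun t => (`|u t| `^ q)%:E).
  move=> mu_; apply/measurable_EFinP.
  by apply: (measurableT_comp (measurable_powR _)) => //; exact: measurableT_comp.
have uE : (\int[mu]_(t in `[0%R, +oo[) `|(`|u t| `^ q)%:E| =
    \int[mu]_(t in `[0%R, +oo[) (`|u t| `^ q)%:E)%E.
  by apply: eq_integral => t _; rewrite gee0_abs// lee_fin powR_ge0.
rewrite /control /mkset -/v.
split=> [/andP[]|[/integrableP[_ iu] mu_]].
  rewrite !inE/= => /mv mu_ /vN iu; split => //.
  by apply/integrableP; rewrite uE; split => //; exact: muq.
apply/andP; split; rewrite !inE/=; first exact/mv.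
by apply/vN; rewrite -uE.
Qed.

Lemma powR_ge_norm (R : realType) (q a : R) : 1 < q -> `|a| <= 1 + `|a| `^ q.
Proof.
move=> q1; have [a1|a1] := leP `|a| 1.
  by rewrite (le_trans a1)// lerDl powR_ge0.
rewrite (@le_trans _ _ (`|a| `^ q))//; last by rewrite lerDr.
by rewrite le1r_powR// ltW.
Qed.

(** Constants are integrable on a bounded interval, and [|u| <= 1 + |u|^q]. *)
Lemma powR_integrable_loc (R : realType) (q T : R) (u : R -> R) : 1 < q ->
  measurable_fun `[0, T] u -> mu.-integrable `[0, T] (fun t => (`|u t| `^ q)%:E) ->
  mu.-integrable `[0, T] (EFin \o u).
Proof.
move=> q1 mu_ iu.
have [T0|T0] := ltP T 0.
  rewrite set_itv_ge ?bnd_simp -?ltNge//; exact: integrable_set0.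
have i1 : mu.-integrable `[0, T] (EFin \o (fun t => 1 + `|u t| `^ q)).
  have -> : EFin \o (fun t => 1 + `|u t| `^ q) =
      (EFin \o cst (1 : R)) \+ (fun t => (`|u t| `^ q)%:E) by [].
  by apply: integrableD => //; exact: cst_itv_integrable.
apply: le_integrable i1 => //; first exact/measurable_EFinP.
move=> t _ /=; rewrite lee_fin [leRHS]ger0_norm ?addr_ge0 ?powR_ge0//.
exact: powR_ge_norm.
Qed.

Lemma control_loc_integrable (R : realType) (q : R) (u : R -> R) : 1 < q ->
  control q u -> loc_integrable u.
Proof.
move=> q1 /(controlP _ q1)[iu mu_] t.
have sub : `[0, t] `<=` `[0, +oo[ by exact: subset_itvcy.
apply: (powR_integrable_loc q1); first exact: measurable_funS mu_.
exact: integrableS iu.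
Qed.

Lemma trajectory0 (R : realType) (n : nat) x0 u (x : R -> 'cV[R]_n.+1) :
  is_trajectory x0 u x -> x 0 = x0.
Proof.
move=> xu; apply/matrixP => i j; rewrite ord1 (trajectory_coord _ xu)//.
by rewrite set_itv1 Rintegral_set1 addr0.
Qed.

Definition running_cost (R : realType) (n : nat) (q : R) (F : 'cV[R]_n.+1 -> R)
  (u : R) (x : 'cV[R]_n.+1) : R := `|u| `^ q / q + F x.

Lemma running_cost_integrable (R : realType) (n : nat) (q : R)
    (F : 'cV[R]_n.+1 -> R) x0 u (x : R -> 'cV[R]_n.+1) (a b : R) : 1 < q ->
  continuous F -> is_trajectory x0 u x -> 0 <= a ->
  mu.-integrable `[a, b] (fun t => (`|u t| `^ q)%:E) ->
  mu.-integrable `[a, b] (fun t => (running_cost q F (u t) (x t))%:E).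
Proof.
move=> q1 cF [cx _] a0 iu.
have iF : mu.-integrable `[a, b] (EFin \o (F \o x)).
  apply: continuous_itv_integrable; apply: comp_within_continuous cF.
  have sub : `[a, b] `<=` `[0, +oo[ by exact: subset_itvcy.
  exact: continuous_subspaceW sub cx.
rewrite /running_cost.
have -> : (fun t => (`|u t| `^ q / q + F (x t))%:E) =
    (fun t => (q^-1)%:E * (`|u t| `^ q)%:E)%E \+ (EFin \o (F \o x)).
  by apply/funext => t /=; rewrite EFinD EFinM muleC.
by apply: integrableD => //; exact: integrableZl.
Qed.

Lemma running_cost_measurable (R : realType) (n : nat) (q : R)
    (F : 'cV[R]_n.+1 -> R) x0 u (x : R -> 'cV[R]_n.+1) :
  continuous F -> is_trajectory x0 u x -> measurable_fun `[(0 : R), +oo[ u ->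
  measurable_fun `[(0 : R), +oo[ (fun t => (running_cost q F (u t) (x t))%:E).
Proof.
move=> cF [cx _] mu_; apply/measurable_EFinP; apply: measurable_funD.
  apply: measurable_funM => //.
  by apply: (measurableT_comp (measurable_powR _)) => //; exact: measurableT_comp.
apply: subspace_continuous_measurable_fun => //.
exact: comp_within_continuous cF.
Qed.

(** * Lower bound for the value function *)

(** Young's inequality for the conjugate exponents [q / (q - 1)] and [q], applied to absolute
    values. *)
Lemma powR_young (R : realType) (q a b : R) : 1 < q ->
  - (a * b) <= (q - 1) / q * `|a| `^ (q / (q - 1)) + `|b| `^ q / q.
Proof.
move=> q1; have q0 : 0 < q by rewrite (lt_trans ltr01).
have p0 : 0 < q - 1 by rewrite subr_gt0.
have -> : (q - 1) / q * `|a| `^ (q / (q - 1)) =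
    `|a| `^ (q / (q - 1)) / (q / (q - 1)) by rewrite invf_div mulrC.
rewrite (@le_trans _ _ (`|a| * `|b|))//.
  by rewrite -normrM -normrN ler_norm.
apply: conjugate_powR => //; first exact: divr_gt0.
by rewrite invf_div -[X in _ + X]mul1r -mulrDl subrK divff// gt_eqF.
Qed.

Lemma pos_def_ge0 (R : realType) (n : nat) (F : 'cV[R]_n.+1 -> R) x :
  pos_def F -> 0 <= F x.
Proof.
by move=> [F0 Fp]; have [->|x0] := eqVneq x 0; [rewrite F0|exact/ltW/Fp].
Qed.

Lemma class_C1_continuous (R : realType) (n : nat) (F : 'cV[R]_n.+1 -> R) :
  class_C1 F -> continuous F.
Proof. by move=> [dF _] x; exact: differentiable_continuous. Qed.

Lemma continuous_dist_lt (R : realType) (U V : normedModType R) (f : U -> V) x e :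
  {for x, continuous f} -> 0 < e ->
  exists2 d, 0 < d & forall y, `|x - y| < d -> `|f x - f y| < e.
Proof. by move=> /cvgrPdist_lt cf /cf /nbhs_normP[d d0 dB]; exists d. Qed.

(* Convexity bounds [F] away from [0] off every neighbourhood of [0], so that
   small [F] forces small [x]; no properness of [W] is needed. *)
Lemma convex_pos_def_small (R : realType) (n : nat) (F W : 'cV[R]_n.+1 -> R) :
  continuous F -> convex_function [set: 'cV[R]_n.+1] F -> pos_def F ->
  continuous W -> W 0 = 0 ->
  forall e, 0 < e -> exists2 d, 0 < d & forall y, F y < d -> W y < e.
Proof.
move=> cF vF pF cW W0 e e0; have [F0 Fp] := pF.
have [r r0 Wr] : exists2 r, 0 < r & forall y : 'cV[R]_n.+1, `|y| <= r -> W y < e.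
  have [r r0 rW] := continuous_dist_lt (cW 0) e0.
  exists (r / 2) => [|y yr]; first by rewrite divr_gt0.
  rewrite (le_lt_trans (ler_norm _))// -normrN -sub0r -W0 rW// sub0r normrN.
  by rewrite (le_lt_trans yr)// ltr_pdivrMr// ltr_pMr// ltr1n.
pose S := [set y : 'cV[R]_n.+1 | `|y| = r].
have S0 : S !=set0.
  exists (const_mx r); rewrite /S /=; apply/eqP; rewrite eq_le; apply/andP; split.
    by apply: mx_norm_le => [|i j]; [exact: ltW|rewrite mxE gtr0_norm].
  by have := le_coord_mx_norm (const_mx r : 'cV[R]_n.+1) 0 0; rewrite mxE gtr0_norm.
have cS : compact S.
  apply: cV_bounded_closed_compact.
    by exists r; split; rewrite ?num_real// => N rN y /= ->; rewrite ltW.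
  have -> : S = (fun y : 'cV[R]_n.+1 => `|y|) @^-1` [set r] by [].
  apply: preimage_closed => [y _|]; first exact: norm_continuous.
  exact: closed_eq.
have [c cS' cmin] := compact_EVT_min S0 cS (continuous_subspaceT cF).
(* The threshold is the minimum of [F] on the sphere of radius [r], positive because the sphere
   avoids [0]. *)
exists (F c).
  apply: Fp; apply/eqP => c0; move: cS'; rewrite inE /S/= c0 normr0 => r0'.
  by move: r0; rewrite -r0' ltxx.
move=> y Fyc; apply: Wr; rewrite leNgt; apply/negP => ry.
have y0 : 0 < `|y| by exact: lt_trans ry.
have t0 : 0 <= r / `|y| by rewrite divr_ge0// ltW.
have t1 : r / `|y| <= 1 by rewrite ler_pdivrMr// mul1r ltW.
(* The segment from [0] to [y] meets the sphere at [(r / |y|) y]; there convexity and [F 0 = 0] give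
   a value at most [F y], hence below the minimum [F c]. *)
have Fty : F (r / `|y| *: y) <= r / `|y| * F y.
  have := vF (Itv01 t0 t1) y 0 (in_setT _) (in_setT _).
  by rewrite convRE F0 mulr0 addr0 /conv/= scaler0 addr0.
have : F c <= F (r / `|y| *: y).
  apply: cmin; rewrite inE /S/= normrZ ger0_norm// divfK// gt_eqF//.
apply/negP; rewrite -ltNge (le_lt_trans Fty)//.
by rewrite (le_lt_trans _ Fyc)// ler_piMl// pos_def_ge0.
Qed.

(** Otherwise [F] is at least [d] along the whole trajectory, and the constant [d] already has
    infinite integral over the ray. *)
Lemma trajectory_cost_exceeds (R : realType) (n : nat) (q : R)
    (F : 'cV[R]_n.+1 -> R) (x0 : 'cV[R]_n.+1) u d : 1 < q -> continuous F -> pos_def F ->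
  control q u -> (cost q F x0 u < +oo)%E -> 0 < d ->
  exists2 t, 0 <= t & F (trajectory x0 u t) < d.
Proof.
move=> q1 cF pF uq cfin d0; apply: contrapT => no.
have xu := trajectoryP x0 (control_loc_integrable q1 uq).
have /(controlP _ q1)[_ mu_] := uq.
have mc := @running_cost_measurable _ _ q _ _ _ _ cF xu mu_.
suff : (+oo <= cost q F x0 u)%E by rewrite leNgt cfin.
have <- : (\int[mu]_(t in `[0%R, +oo[) (cst d%:E t) = +oo)%E.
  by rewrite integral_cst//= lebesgue_measure_itv/= ltry oppr0 adde0 gt0_muley ?lte_fin.
apply: ge0_le_integral => //.
- by move=> t _ /=; rewrite lee_fin ltW.
- move=> t; rewrite /= in_itv/= andbT => t0; rewrite lee_fin.
  have Fd : d <= F (trajectory x0 u t).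
    by rewrite leNgt; apply/negP => Fd; apply: no; exists t.
  by rewrite (le_trans Fd)// lerDr divr_ge0 ?powR_ge0// ltW// (lt_trans ltr01).
Qed.

Lemma cost_ge_finite_horizon (R : realType) (n : nat) (q : R)
    (F : 'cV[R]_n.+1 -> R) (x0 : 'cV[R]_n.+1) u T : 1 < q -> continuous F -> pos_def F ->
  control q u ->
  ((\int[mu]_(t in `[0, T]) running_cost q F (u t) (trajectory x0 u t))%:E
    <= cost q F x0 u)%E.
Proof.
move=> q1 cF pF uq.
have xu := trajectoryP x0 (control_loc_integrable q1 uq).
have /(controlP _ q1)[iu mu_] := uq.
have q0 : 0 <= q by rewrite ltW// (lt_trans ltr01).
have sub : `[0, T] `<=` `[0, +oo[ by exact: subset_itvcy.
have iuT : mu.-integrable `[0, T] (fun t => (`|u t| `^ q)%:E).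
  exact: integrableS iu.
have ic := running_cost_integrable q1 cF xu (lexx 0) iuT.
rewrite /Rintegral fineK; last exact: integrable_fin_num.
apply: ge0_subset_integral => //.
  exact: running_cost_measurable cF xu mu_.
by move=> t _; rewrite lee_fin addr_ge0 ?pos_def_ge0// divr_ge0 ?powR_ge0.
Qed.

Lemma subsolution_le_value (R : realType) (n : nat) (q : R)
    (F W : 'cV[R]_n.+1 -> R) : 1 < q ->
  class_C1 F -> convex_function [set: 'cV[R]_n.+1] F -> pos_def F ->
  class_C1 W -> pos_def W ->
  (forall x : 'cV[R]_n.+1,
      ((grad W x)^T *m (jordan_block R n.+1 *m x)) 0 0
      - (q - 1) / q * `|grad W x ord_max 0| `^ (q / (q - 1)) >= - F x) ->
  forall x : 'cV[R]_n.+1, ((W x)%:E <= value q F x)%E.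
Proof.
move=> q1 F1 vF pF W1 pW HJ x0; apply: le_ereal_inf_tmp => _ [u uq <-].
have cF := class_C1_continuous F1; have cW := class_C1_continuous W1.
have [cfin|] := ltP (cost q F x0 u) +oo%E; last first.
  by rewrite leye_eq => /eqP ->; rewrite leey.
apply/lee_addgt0Pr => e e0.
have [d d0 Fd] := convex_pos_def_small cF vF pF cW pW.1 e0.
have [T T0 FT] := trajectory_cost_exceeds q1 cF pF uq cfin d0.
have uL := control_loc_integrable q1 uq.
have xu := trajectoryP x0 uL.
have [ip Wx] := trajectory_chain_rule W1 xu uL (lexx 0) T0.
apply: le_trans (leeD2r _ (cost_ge_finite_horizon x0 T q1 cF pF uq)).
have /(controlP _ q1)[iu mu_] := uq.
have sub : `[0, T] `<=` `[0, +oo[ by exact: subset_itvcy.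
have iuT : mu.-integrable `[0, T] (fun t => (`|u t| `^ q)%:E).
  exact: integrableS iu.
have ic := running_cost_integrable q1 cF xu (lexx 0) iuT.
rewrite -EFinD lee_fin.
have WT := ltW (Fd _ FT).
rewrite (trajectory0 xu) in Wx.
(* [HJ] and Young's inequality make the integrand nonnegative; [power] integrates to the increment
   of [W], whose final value is at most [e]. *)
have : 0 <= \int[mu]_(t in `[0, T]) (running_cost q F (u t) (trajectory x0 u t)
   + power W (u t) (trajectory x0 u t)).
  apply: Rintegral_ge0 => t _; rewrite /running_cost /power.
  have := HJ (trajectory x0 u t).
  have := powR_young (grad W (trajectory x0 u t) ord_max 0) (u t) q1.
  lra.
by rewrite RintegralD// -Wx; move: WT; lra.
Qed.

(** * Optimal feedback *)

(** The minimiser of [b c + |c|^q / q] over [c], where [b] stands for the last partial derivative of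
    [W]. *)
Definition feedback (R : realType) (q b : R) : R :=
  - Num.sg b * `|b| `^ (q - 1)^-1.

Lemma feedback_norm (R : realType) (q b : R) : 1 < q ->
  `|feedback q b| = `|b| `^ (q - 1)^-1.
Proof.
move=> q1; rewrite /feedback normrM normrN normr_sg (ger0_norm (powR_ge0 _ _)).
(* At [b = 0] the sign vanishes, and so does the power, its exponent being nonzero. *)
have [->|b0] := eqVneq b 0; last by rewrite mul1r.
by rewrite mul0r normr0 powR0// invr_eq0 subr_eq0 gt_eqF.
Qed.

(** Equality case of [powR_young]: both terms on the left are multiples of the same power of
    [|b|]. *)
Lemma feedback_young (R : realType) (q b : R) : 1 < q ->
  b * feedback q b + `|feedback q b| `^ q / q =
  - ((q - 1) / q * `|b| `^ (q / (q - 1))).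
Proof.
move=> q1; have q0 : q != 0 by rewrite gt_eqF// (lt_trans ltr01).
have p0 : q - 1 != 0 by rewrite subr_eq0 gt_eqF.
have qE : q / (q - 1) = 1 + (q - 1)^-1 by field.
rewrite feedback_norm// -powRrM [_^-1 * q]mulrC.
have -> : b * feedback q b = - `|b| `^ (q / (q - 1)).
  rewrite /feedback mulNr mulrN mulrA [b * _]mulrC -normrEsg qE; congr (- _).
  have [->|b0] := eqVneq `|b| 0.
    by rewrite mul0r powR0// -qE mulf_neq0 ?invr_eq0.
  by rewrite powRD ?b0 ?implybT// powRr1.
by field.
Qed.

Lemma feedback_dissipation (R : realType) (n : nat) (q : R)
    (F W : 'cV[R]_n.+1 -> R) (x : 'cV[R]_n.+1) : 1 < q ->
  ((grad W x)^T *m (jordan_block R n.+1 *m x)) 0 0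
      - (q - 1) / q * `|grad W x ord_max 0| `^ (q / (q - 1)) <= - F x ->
  power W (feedback q (grad W x ord_max 0)) x +
    running_cost q F (feedback q (grad W x ord_max 0)) x <= 0.
Proof.
move=> q1; rewrite /power /running_cost.
have := feedback_young (grad W x ord_max 0) q1.
lra.
Qed.

(** * Sampled feedback on bounded horizons *)

(** Integrability is only local: a held control keeps its last value for ever and need not belong to
    [L^q] on the ray. *)
Definition loc_Lq (R : realType) (q : R) (u : R -> R) :=
  measurable_fun setT u /\
  forall t, mu.-integrable `[0, t] (fun s => (`|u s| `^ q)%:E).

Lemma loc_Lq_integrable (R : realType) (q : R) (u : R -> R) : 1 < q ->
  loc_Lq q u -> loc_integrable u.
Proof.
by move=> q1 [mu_ iu] t; apply: powR_integrable_loc q1 _ _ => //; exact: measurable_funTS.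
Qed.

(** The value at [T] itself is that of [u], so that state and cost up to [T] are unchanged; [c]
    persists until a later step replaces it. *)
Definition hold (R : realType) (u : R -> R) (T c : R) : R -> R :=
  fun s => if s <= T then u s else c.

Lemma hold_loc_Lq (R : realType) (q : R) (u : R -> R) (T c : R) :
  loc_Lq q u -> loc_Lq q (hold u T c).
Proof.
move=> [mu_ iu].
have mh : measurable_fun setT (hold u T c).
  by apply: measurable_fun_ifT => //; exact: measurable_fun_ler.
split=> // t.
have ic := cst_itv_integrable 0 t (`|c| `^ q).
have iuc : mu.-integrable `[0, t] (EFin \o (fun s => `|u s| `^ q + `|c| `^ q)).
  exact: (integrableD _ (iu t) ic).
apply: le_integrable iuc => //.
  apply/measurable_EFinP/measurable_funTS.
  by apply: (measurableT_comp (measurable_powR _)) => //; exact: measurableT_comp.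
move=> s _ /=; rewrite lee_fin (ger0_norm (powR_ge0 _ _)).
rewrite (ger0_norm (addr_ge0 (powR_ge0 _ _) (powR_ge0 _ _))) /hold.
by case: ifPn => _; rewrite ?lerDl ?lerDr powR_ge0.
Qed.

(* The budget [e] is spent at the rate of [T / (1 + T)], so that it is never
   exhausted and, on bounded time intervals, is spent at a positive rate. *)
Definition near_optimal (R : realType) (n : nat) (q : R) (F W : 'cV[R]_n.+1 -> R)
    (x0 : 'cV[R]_n.+1) (e T : R) (u : R -> R) :=
  loc_Lq q u /\
  \int[mu]_(t in `[0, T]) running_cost q F (u t) (trajectory x0 u t)
    + W (trajectory x0 u T) <= W x0 + e * (T / (1 + T)).

(** As [W >= 0] and [T / (1 + T) <= 1], the cost on [[0, T]] is at most [W x0 + e], and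
    [|u| <= 1 + |u|^q] is at most [1] plus [q] times the running cost. The bound depends on [B] but
    not on [T] or [u]. *)
Lemma near_optimal_bound (R : realType) (n : nat) (q : R) (F W : 'cV[R]_n.+1 -> R)
    (x0 : 'cV[R]_n.+1) (e T B : R) u : 1 < q ->
  continuous F -> pos_def F -> pos_def W -> 0 <= e -> 0 <= T -> T <= B ->
  near_optimal q F W x0 e T u ->
  \int[mu]_(t in `[0, T]) `|u t| <= B + q * (W x0 + e).
Proof.
move=> q1 cF pF pW e0 T0 TB [uq].
have q0 : 0 < q by rewrite (lt_trans ltr01).
have uL := loc_Lq_integrable q1 uq.
have xu := trajectoryP x0 uL.
have ic := running_cost_integrable q1 cF xu (lexx 0) (uq.2 T).
set x := trajectory x0 u in xu ic *.
have W0 := pos_def_ge0 (x T) pW.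
have eT : e * (T / (1 + T)) <= e.
  by rewrite ler_piMr// ler_pdivrMr ?mul1r ?lerDr// ltr_wpDr.
have i1 := cst_itv_integrable 0 T 1.
have iqc : mu.-integrable `[0, T]
    (EFin \o (fun t => q * running_cost q F (u t) (x t))).
  exact: (integrableZl _ q ic).
have i1qc : mu.-integrable `[0, T]
    (EFin \o (fun t => 1 + q * running_cost q F (u t) (x t))).
  exact: (integrableD _ i1 iqc).
have : \int[mu]_(t in `[0, T]) `|u t| <=
    \int[mu]_(t in `[0, T]) (1 + q * running_cost q F (u t) (x t)).
  apply: le_Rintegral => //; first exact: integrable_norm (uL T).
  move=> t _; rewrite (le_trans (powR_ge_norm (u t) q1))// lerD2l.
  rewrite /running_cost mulrDr mulrCA divff ?mulr1 ?gt_eqF// lerDl.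
  by rewrite mulr_ge0 ?pos_def_ge0// ltW.
move=> h1 h2; apply: (le_trans h1).
rewrite (RintegralD _ i1 iqc)// (RintegralZl _ _ ic)//.
rewrite lerD//; last by rewrite ler_wpM2l ?(ltW q0)//; lra.
by rewrite (Rintegral_itv_cst 1 T0) mul1r subr0.
Qed.

(** The increment of [T / (1 + T)] is [(T' - T) / ((1 + T) (1 + T'))], and both factors of the
    denominator are at most [1 + B]. *)
Lemma power_rate (R : realType) (e B T T' : R) : 0 <= e -> 0 <= T -> T <= T' ->
  T' <= B ->
  e * (T / (1 + T)) + e / (1 + B) ^+ 2 * (T' - T) <= e * (T' / (1 + T')).
Proof.
move=> e0 T0 TT' T'B.
have t0 : 0 < 1 + T by lra.
have t'0 : 0 < 1 + T' by lra.
have b0 : 0 < 1 + B by lra.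
rewrite -mulrA -mulrDr ler_wpM2l// -lerBrDl.
have -> : T' / (1 + T') - T / (1 + T) = ((1 + T) * (1 + T'))^-1 * (T' - T).
  by field; rewrite !gt_eqF.
rewrite ler_wpM2r ?subr_ge0// lef_pV2 ?posrE ?mulr_gt0 ?exprn_gt0//.
by rewrite expr2; apply: ler_pM; lra.
Qed.

Lemma sumM_continuous (R : realType) (T : topologicalType) (n : nat)
    (f g : 'I_n -> T -> R) : (forall i, continuous (f i)) ->
  (forall i, continuous (g i)) -> continuous (fun y => \sum_i f i y * g i y).
Proof.
move=> cf cg; apply: continuous_big => [|i _ y]; first exact: add_continuous.
by apply: cvgM; [exact: cf|exact: cg].
Qed.

(** The terms [|c|^q / q] cancel. The rest is uniformly continuous in the state on the ball, and [c]
    enters it linearly with size at most [K]. *)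
Lemma dissipation_unif (R : realType) (n : nat) (q : R)
    (F W : 'cV[R]_n.+1 -> R) (M K r : R) : continuous F -> class_C1 W ->
  0 <= K -> 0 < r -> exists2 d, 0 < d & forall x y c, `|x| <= M -> `|y| <= M ->
    `|x - y| < d -> `|c| <= K ->
    power W c x + running_cost q F c x <= power W c y + running_cost q F c y + r.
Proof.
move=> cF [dW cW] K0 r0.
pose G1 y := ((grad W y)^T *m (jordan_block R n.+1 *m y)) 0 0 + F y.
have cgrad i : continuous (fun y => grad W y i 0).
  move=> y; apply: (@continuous_comp _ _ _ (grad W) (fun M => M i 0)); first exact: cW.
  exact: coord_continuous.
have cdrift : continuous
    (fun y => ((grad W y)^T *m (jordan_block R n.+1 *m y)) 0 0).
  have -> : (fun y => ((grad W y)^T *m (jordan_block R n.+1 *m y)) 0 0) =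
      (fun y => \sum_i grad W y i 0 * \sum_j jordan_block R n.+1 i j * y j 0).
    apply/funext => y; rewrite mxE; apply: eq_bigr => i _.
    by congr (_ * _); rewrite [LHS]mxE.
  apply: sumM_continuous => // i.
  apply: sumM_continuous => j; first exact: cst_continuous.
  exact: coord_continuous.
have cG1 : continuous G1 by move=> y; exact: (cvgD (cdrift y) (cF y)).
have r2 : 0 < r / 2 by rewrite divr_gt0.
have [d1 d10 G1d] := compact_unif_dist (@cV_ball_compact R n.+1 M)
  (continuous_subspaceT cG1) r2.
(* With this tolerance the gradient difference times [c] stays below [r / 2]; [K + 1] avoids
   dividing by zero. *)
have r20 : 0 < r / 2 / (K + 1) by rewrite !divr_gt0// ltr_wpDl.
have [d2 d20 G2d] := compact_unif_dist (@cV_ball_compact R n.+1 M)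
  (continuous_subspaceT (cgrad ord_max)) r20.
exists (Num.min d1 d2); first by rewrite lt_min d10.
move=> x y c xM yM; rewrite lt_min => /andP[xy1 xy2] cK.
have := G1d x y xM yM xy1; have := G2d x y xM yM xy2.
rewrite /G1 => h2 h1.
have h3 : (grad W x ord_max 0 - grad W y ord_max 0) * c <= r / 2.
  rewrite (le_trans (ler_norm _))// normrM.
  rewrite (@le_trans _ _ (r / 2 / (K + 1) * (K + 1)))//; last first.
    by rewrite divfK// gt_eqF// ltr_wpDl.
  by rewrite ler_pM// ?(ltW h2)// (le_trans cK)// lerDl.
have := ler_norm ((((grad W x)^T *m (jordan_block R n.+1 *m x)) 0 0 + F x)
  - (((grad W y)^T *m (jordan_block R n.+1 *m y)) 0 0 + F y)).
rewrite /power /running_cost; lra.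
Qed.

(** After [T] each coordinate of the velocity is either a coordinate of the state or the held value
    [c], hence at most [M + K] in absolute value. *)
Lemma hold_displacement (R : realType) (n : nat) x0 u
    (x : R -> 'cV[R]_n.+1) (T T' M K c : R) : loc_integrable (hold u T c) ->
  is_trajectory x0 (hold u T c) x -> 0 <= T ->
  (forall t, 0 <= t <= T' -> `|x t| <= M) -> `|c| <= K ->
  forall t, T <= t <= T' -> `|x t - x T| <= (M + K) * (t - T).
Proof.
move=> uL xu T0 xM cK t /andP[Tt tT'].
have M0 : 0 <= M by rewrite (le_trans _ (xM T _))// T0 (le_trans Tt).
have K0 : 0 <= K by rewrite (le_trans _ cK).
apply: mx_norm_le => [|i j]; first by rewrite mulr_ge0 ?subr_ge0 ?addr_ge0.
rewrite ord1 !mxE (trajectory_increment i xu uL T0 Tt).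
have iv : mu.-integrable `[T, t] (EFin \o (fun s => velocity (hold u T c) x s i 0)).
  exact: (loc_integrable_itv _ (velocity_loc_integrable i xu uL) T0).
rewrite (le_trans (le_normr_Rintegral _ _))//.
apply: Rintegral_le_cst => //; first exact: integrable_norm.
move=> s /andP[Ts st]; have [h|h] := ltnP i.+1 n.+1.
  rewrite (velocity_lt _ _ h) (le_trans (le_coord_mx_norm _ _ _))//.
  rewrite (le_trans (xM s _)) ?lerDl// (le_trans T0 (ltW Ts))/=.
  exact: le_trans tT'.
have -> : i = ord_max.
  by apply: val_inj => /=; apply/eqP; rewrite eqn_leq -ltnS ltn_ord.
by rewrite velocity_max /hold (leNgt s T) Ts/= (le_trans cK)// lerDr.
Qed.

Lemma hold_trajectory (R : realType) (n : nat) (q : R) (x0 : 'cV[R]_n.+1) u T c t :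
  1 < q -> loc_Lq q u -> 0 <= t <= T ->
  trajectory x0 (hold u T c) t = trajectory x0 u t.
Proof.
move=> q1 uq tT.
have xu := trajectoryP x0 (loc_Lq_integrable q1 uq).
have xh := trajectoryP x0 (loc_Lq_integrable q1 (hold_loc_Lq T c uq)).
by apply: (trajectory_causal xh xu _ tT) => s /andP[_ sT]; rewrite /hold sT.
Qed.

Lemma dissipation_integral (R : realType) (n : nat) (q : R)
    (F W : 'cV[R]_n.+1 -> R) x0 v (z : R -> 'cV[R]_n.+1) (T T' r : R) : 1 < q ->
  continuous F -> class_C1 W -> loc_Lq q v -> is_trajectory x0 v z ->
  0 <= T -> T <= T' ->
  (forall t, T < t <= T' ->
     power W (v t) (z t) + running_cost q F (v t) (z t) <= r) ->
  \int[mu]_(t in `[T, T']) running_cost q F (v t) (z t) + W (z T') <=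
    W (z T) + r * (T' - T).
Proof.
move=> q1 cF W1 vq zv T0 TT' vr.
have [ip Wz] := trajectory_chain_rule W1 zv (loc_Lq_integrable q1 vq) T0 TT'.
have iq : mu.-integrable `[T, T'] (fun t => (`|v t| `^ q)%:E).
  by apply: integrableS (vq.2 T') => //; exact: subset_itvcc.
have ic := running_cost_integrable q1 cF zv T0 iq.
have ipc : mu.-integrable `[T, T'] (EFin \o (fun t =>
    power W (v t) (z t) + running_cost q F (v t) (z t))).
  exact: (integrableD _ ip ic).
have := Rintegral_le_cst TT' ipc vr.
rewrite RintegralD// -Wz; lra.
Qed.

Lemma mul_le_div_succ (R : realType) (a s d : R) :
  0 <= a -> 0 < d -> s <= d / (a + 1) -> a * s < d.
Proof.
move=> a0 d0 sd; have a10 : 0 < a + 1 by rewrite ltr_wpDl.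
rewrite (@le_lt_trans _ _ (a * (d / (a + 1))))// ?ler_wpM2l//.
by rewrite mulrCA gtr_pMr// ltr_pdivrMr// mul1r ltrDl.
Qed.

(** The order of quantifiers matters: [h] is fixed before [T] and [u]. The extension holds the
    feedback computed at the state reached at time [T]; a short step keeps the state close to it, so
    that dissipation fails by at most a rate [r]. *)
Lemma near_optimal_step (R : realType) (n : nat) (q : R)
    (F W : 'cV[R]_n.+1 -> R) (x0 : 'cV[R]_n.+1) (e B : R) : 1 < q ->
  continuous F -> pos_def F -> class_C1 W -> pos_def W ->
  (forall x : 'cV[R]_n.+1,
      ((grad W x)^T *m (jordan_block R n.+1 *m x)) 0 0
      - (q - 1) / q * `|grad W x ord_max 0| `^ (q / (q - 1)) <= - F x) ->
  0 < e -> 0 <= B ->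
  exists2 h, 0 < h & forall T T' u, 0 <= T -> T <= T' -> T' <= B ->
    T' - T <= h -> near_optimal q F W x0 e T u ->
    exists2 v, near_optimal q F W x0 e T' v & forall s, s <= T -> v s = u s.
Proof.
move=> q1 cF pF W1 pW HJ e0 B0; have [dW cW] := W1.
have q0 : 0 < q by rewrite (lt_trans ltr01).
(* [A] bounds the [L^1] norm on [[0, T]] of every near-optimal control with [T <= B]; [M] then
   bounds the state at time [T]. *)
pose A := B + q * (W x0 + e).
have A0 : 0 <= A by rewrite addr_ge0// mulr_ge0 ?(ltW q0)// addr_ge0 ?pos_def_ge0// ltW.
pose M := (`|x0| + A) * (1 + B) ^+ n.
have [K K0 fK] : exists2 K, 0 <= K &
    forall y, `|y| <= M -> `|feedback q (grad W y ord_max 0)| <= K.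
  have cg : continuous (fun y => grad W y ord_max 0).
    move=> y; apply: (@continuous_comp _ _ _ (grad W) (fun M => M ord_max 0)).
      exact: cW.
    exact: coord_continuous.
  have /compact_bounded[L [_ gL]] := continuous_compact (continuous_subspaceT cg)
    (@cV_ball_compact R n.+1 M).
  exists ((`|L| + 1) `^ (q - 1)^-1) => [|y yM]; first exact: powR_ge0.
  rewrite feedback_norm//; apply: ge0_ler_powR; rewrite ?nnegrE ?addr_ge0//.
    by rewrite invr_ge0 subr_ge0 ltW.
  by apply: gL; [rewrite (le_lt_trans (ler_norm _))// ltrDl|exists y].
(* Holding a value of size at most [K] up to time [B] adds at most [K * B] to the [L^1] norm, so
   [M'] bounds the extended trajectory. *)
pose M' := (`|x0| + (A + K * B)) * (1 + B) ^+ n.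
have AK0 : 0 <= A + K * B by rewrite addr_ge0// mulr_ge0.
have M'0 : 0 <= M' by rewrite mulr_ge0 ?exprn_ge0// addr_ge0.
(* The least rate at which the budget [e * (T / (1 + T))] grows on [[0, B]]; the sampling error has
   to stay below it. *)
pose r := e / (1 + B) ^+ 2.
have r0 : 0 < r by rewrite divr_gt0// exprn_gt0// ltr_pwDl.
have [d d0 Gd] := dissipation_unif q M' cF W1 K0 r0.
have MK0 : 0 < M' + K + 1 by rewrite ltr_wpDl// addr_ge0.
(* The state moves at speed at most [M' + K], so it stays within [d] of its sampled value; the added
   [1] makes the inequality strict. *)
exists (d / (M' + K + 1)) => [|T T' u T0 TT' T'B T'h uopt]; first exact: divr_gt0.
have T'0 : 0 <= T' by exact: le_trans TT'.
have TB : T <= B by exact: le_trans T'B.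
have [uq uE] := uopt.
have uA := near_optimal_bound q1 cF pF pW (ltW e0) T0 TB uopt.
have uL := loc_Lq_integrable q1 uq.
have xu := trajectoryP x0 uL.
set x := trajectory x0 u in uE xu.
have xTM : `|x T| <= M.
  rewrite (le_trans (trajectory_bound xu uL uA _)) ?T0 ?lexx//.
  apply: ler_wpM2l; first exact: addr_ge0.
  by apply: lerXn2r; rewrite ?nnegrE; lra.
pose c := feedback q (grad W (x T) ord_max 0).
have cK : `|c| <= K by exact: fK.
have fd := feedback_dissipation q1 (HJ (x T)); rewrite -/c in fd.
clearbody c.
exists (hold u T c); last by move=> s sT; rewrite /hold sT.
have vq := hold_loc_Lq T c uq.
have vL := loc_Lq_integrable q1 vq.
have xv := trajectoryP x0 vL.
set z := trajectory x0 (hold u T c) in xv.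
have zx t : 0 <= t <= T -> z t = x t by exact: (hold_trajectory x0 c q1 uq).
split; first exact: vq.
rewrite -/z; clearbody z x.
have vA : \int[mu]_(t in `[0, T']) `|hold u T c t| <= A + K * B.
  have iv : mu.-integrable `[0, T'] (EFin \o (fun t => `|hold u T c t|)).
    exact: integrable_norm (vL T').
  rewrite (Rintegral_chasles T0 TT' iv) lerD//.
    rewrite (_ : Rintegral _ _ _ = \int[mu]_(t in `[0, T]) `|u t|)//.
    apply: eq_Rintegral => t.
    by rewrite inE/= in_itv/= /hold => /andP[_ ->].
  rewrite (@le_trans _ _ (K * (T' - T)))//.
    apply: Rintegral_le_cst => //.
      by apply: integrableS iv => //; exact: subset_itvcc.
    by move=> t /andP[Tt _]; rewrite /hold (leNgt t T) Tt.
  by rewrite ler_wpM2l//; lra.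
have zM t : 0 <= t <= T' -> `|z t| <= M'.
  move=> tT'; rewrite (le_trans (trajectory_bound xv vL vA tT'))//.
  apply: ler_wpM2l; first exact: addr_ge0.
  by apply: lerXn2r; rewrite ?nnegrE; lra.
have zT : z T = x T by rewrite zx// T0 lexx.
have ic := running_cost_integrable q1 cF xv (lexx 0) (vq.2 T').
have dis : \int[mu]_(t in `[T, T']) running_cost q F (hold u T c t) (z t) +
    W (z T') <= W (z T) + r * (T' - T).
  apply: (dissipation_integral q1 cF W1 vq xv T0 TT') => t /andP[Tt tT'].
  rewrite /hold (leNgt t T) Tt /=.
  have zxd : `|z t - x T| < d.
    have := hold_displacement vL xv T0 zM cK (introT andP (conj (ltW Tt) tT')).
    rewrite zT => /le_lt_trans; apply.
    apply: mul_le_div_succ d0 _; first exact: addr_ge0.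
    by apply: le_trans T'h; rewrite lerD2r.
  have tM : `|z t| <= M' by apply: zM; rewrite tT' andbT (le_trans T0)// ltW.
  have TM : `|x T| <= M' by rewrite -zT; apply: zM; rewrite T0.
  apply: (le_trans (Gd _ _ _ tM TM zxd cK)).
  by rewrite gerDr.
rewrite (Rintegral_chasles T0 TT' ic).
have -> : \int[mu]_(t in `[0, T]) running_cost q F (hold u T c t) (z t) =
    \int[mu]_(t in `[0, T]) running_cost q F (u t) (x t).
  apply: eq_Rintegral => t; rewrite inE/= in_itv/= => tT.
  by rewrite zx// /hold; move: tT => /andP[_ ->].
(* The error [r * (T' - T)] is paid by the budget released between [T] and [T']. *)
have := power_rate (ltW e0) T0 TT' T'B; rewrite -/r.
move: dis uE; rewrite zT; lra.
Qed.

(** The step length is uniform on [[0, B]], so finitely many steps, each cut off at [B], reach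
    [B]. *)
Lemma near_optimal_extend (R : realType) (n : nat) (q : R)
    (F W : 'cV[R]_n.+1 -> R) (x0 : 'cV[R]_n.+1) (e B T : R) u : 1 < q ->
  continuous F -> pos_def F -> class_C1 W -> pos_def W ->
  (forall x : 'cV[R]_n.+1,
      ((grad W x)^T *m (jordan_block R n.+1 *m x)) 0 0
      - (q - 1) / q * `|grad W x ord_max 0| `^ (q / (q - 1)) <= - F x) ->
  0 < e -> 0 <= T -> T <= B -> near_optimal q F W x0 e T u ->
  exists2 v, near_optimal q F W x0 e B v & forall s, s <= T -> v s = u s.
Proof.
move=> q1 cF pF W1 pW HJ e0 T0 TB uT.
have [h h0 step] := near_optimal_step x0 q1 cF pF W1 pW HJ e0 (le_trans T0 TB).
have [N BN] : exists N, (B - T) <= h *+ N.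
  exists (Num.bound ((B - T) / h)); rewrite -mulr_natl -ler_pdivrMr//.
  by apply/ltW/archi_boundP; rewrite divr_ge0 ?subr_ge0// ltW.
elim: N T u T0 TB uT BN => [|N IH] T u T0 TB uT.
  rewrite mulr0n subr_le0 => BT; exists u => //.
  by rewrite (le_anti (introT andP (conj BT TB))).
rewrite mulrS => BN.
pose T' := Num.min B (T + h).
have TT' : T <= T' by rewrite le_min TB lerDl ltW.
have T'B : T' <= B by rewrite ge_min lexx.
have T'h : T' - T <= h by rewrite lerBlDl ge_min lexx orbT.
have [v vT' vu] := step T T' u T0 TT' T'B T'h uT.
have [|w wB wv] := IH T' v (le_trans T0 TT') T'B vT'.
  rewrite lerBlDr -lerBlDl le_min; apply/andP; split; last lra.
  by rewrite gerBl mulrn_wge0// ltW.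
exists w => // s sT; rewrite wv ?vu//; exact: le_trans TT'.
Qed.

Lemma near_optimal_start (R : realType) (n : nat) (q : R)
    (F W : 'cV[R]_n.+1 -> R) (x0 : 'cV[R]_n.+1) (e : R) : 1 < q ->
  near_optimal q F W x0 e 0 (fun=> 0).
Proof.
move=> q1; have q0 : q != 0 by rewrite gt_eqF// (lt_trans ltr01).
have uq : loc_Lq q (fun=> 0 : R).
  split => [|t]; first exact: measurable_cst.
  by rewrite normr0 powR0//; exact: cst_itv_integrable.
split=> //; have xu := trajectoryP x0 (loc_Lq_integrable q1 uq).
by rewrite set_itv1 Rintegral_set1 (trajectory0 xu) mul0r mulr0 add0r addr0.
Qed.

(** * Passage to the infinite horizon *)

(** Near-optimality at time [j] concerns [[0, j]] only; the agreement of later controls with earlier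
    ones allows gluing them into a single control. *)
Lemma near_optimal_chain (R : realType) (n : nat) (q : R)
    (F W : 'cV[R]_n.+1 -> R) (x0 : 'cV[R]_n.+1) (e : R) : 1 < q ->
  continuous F -> pos_def F -> class_C1 W -> pos_def W ->
  (forall x : 'cV[R]_n.+1,
      ((grad W x)^T *m (jordan_block R n.+1 *m x)) 0 0
      - (q - 1) / q * `|grad W x ord_max 0| `^ (q / (q - 1)) <= - F x) ->
  0 < e -> exists w : nat -> R -> R,
    forall j, near_optimal q F W x0 e j%:R (w j) /\
      forall k s, (j <= k)%N -> s <= j%:R -> w k s = w j s.
Proof.
move=> q1 cF pF W1 pW HJ e0.
(* Near-optimality is a premise inside the chosen property, so that [f] is total; on other pairs its
   value is arbitrary. *)
have /choice[f fP] : forall ju : nat * (R -> R), exists v,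
    near_optimal q F W x0 e ju.1%:R ju.2 ->
    near_optimal q F W x0 e ju.1.+1%:R v /\ forall s, s <= ju.1%:R -> v s = ju.2 s.
  move=> [j u] /=.
  have [uj|] := pselect (near_optimal q F W x0 e j%:R u); last by exists u.
  have jj : j%:R <= j.+1%:R :> R by rewrite ler_nat.
  have [v vj vu] := near_optimal_extend q1 cF pF W1 pW HJ e0 (ler0n _ j) jj uj.
  by exists v.
pose w j := iteri j (fun i u => f (i, u)) (fun=> 0).
have wopt j : near_optimal q F W x0 e j%:R (w j).
  elim: j => [|j IH]; first exact: near_optimal_start.
  by have [] := fP (j, w j) IH.
exists w => j; split=> // k s; elim: k => [|k IH]; first by rewrite leqn0 => /eqP ->.
rewrite leq_eqVlt => /predU1P[<-//|jk sj]; rewrite -IH//.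
have [_ fwk] := fP (k, w k) (wopt k).
rewrite -[LHS]/(f (k, w k) s) fwk//=.
by rewrite (le_trans sj)// ler_nat.
Qed.

Lemma ray_bigcup (R : realType) : `[(0 : R), +oo[%classic = \bigcup_j `[0, j%:R]%classic.
Proof.
apply/seteqP; split => t /=; last first.
  by move=> [j _]; rewrite /= !in_itv/= andbT => /andP[].
rewrite in_itv/= andbT => t0; exists (Num.bound t) => //=.
by rewrite in_itv/= t0 ltW// archi_boundP.
Qed.

(** Monotone convergence along the increasing segments [[0, j]]. *)
Lemma le_integral_ray (R : realType) (f : R -> \bar R) (C : \bar R) :
  measurable_fun `[(0 : R), +oo[ f -> (forall t, (0 <= f t)%E) ->
  (forall j : nat, (\int[mu]_(t in `[0%R, j%:R]) f t <= C)%E) ->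
  (\int[mu]_(t in `[0%R, +oo[) f t <= C)%E.
Proof.
move=> mf f0 fC; rewrite ray_bigcup.
have cvgf : (\int[mu]_(t in `[0%R, j%:R]) f t)%E @[j --> \oo] -->
    (\int[mu]_(t in \bigcup_j `[0%R, j%:R]%classic) f t)%E.
  apply: ge0_nondecreasing_set_cvg_integral => //.
    by move=> i j ij; apply/subsetPset; apply: subset_itvcc; rewrite ?ler_nat.
  by move=> j; apply: measurable_funS mf => //; exact: subset_itvcy.
by apply: cvge_le cvgf; apply: nearW => j; exact: fC.
Qed.

Lemma value_le_supersolution (R : realType) (n : nat) (q : R)
    (F W : 'cV[R]_n.+1 -> R) : 1 < q ->
  class_C1 F -> pos_def F -> class_C1 W -> pos_def W ->
  (forall x : 'cV[R]_n.+1,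
      ((grad W x)^T *m (jordan_block R n.+1 *m x)) 0 0
      - (q - 1) / q * `|grad W x ord_max 0| `^ (q / (q - 1)) <= - F x) ->
  forall x : 'cV[R]_n.+1, (value q F x <= (W x)%:E)%E.
Proof.
move=> q1 F1 pF W1 pW HJ x0; apply/lee_addgt0Pr => e e0.
have q0 : 0 < q by rewrite (lt_trans ltr01).
have cF := class_C1_continuous F1.
have [w wP] := near_optimal_chain x0 q1 cF pF W1 pW HJ e0.
pose u (t : R) := w (Num.truncn t).+1 t.
have uw j s : s <= j%:R -> u s = w j s.
  move=> sj; have ts := ltW (truncnS_gt s).
  have [jt|tj] := leqP j (Num.truncn s).+1; first by rewrite /u (wP j).2.
  by rewrite ((wP (Num.truncn s).+1).2 j)// ltnW.
clearbody u.
have mu_ : measurable_fun `[(0 : R), +oo[ u.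
  rewrite ray_bigcup; apply/measurable_fun_bigcup => // j.
  apply: (@eq_measurable_fun _ _ _ _ _ (w j)).
    by move=> t; rewrite inE/= in_itv/= => /andP[_ tj]; rewrite (uw j).
  exact: measurable_funTS (wP j).1.1.1.
have uL : loc_integrable u.
  move=> t; have [j tj] : exists j : nat, t <= j%:R.
    by exists (Num.truncn t).+1; exact/ltW/truncnS_gt.
  apply: eq_integrable (loc_Lq_integrable q1 (wP j).1.1 t) => //.
  move=> s; rewrite inE/= in_itv/= => /andP[_ st].
  by rewrite (uw j)// (le_trans st).
have xu := trajectoryP x0 uL.
(* By causality the glued control and [w j] have the same trajectory, hence the same cost, up to
   time [j]. *)
have xw j t : 0 <= t <= j%:R -> trajectory x0 u t = trajectory x0 (w j) t.
  have xwj := trajectoryP x0 (loc_Lq_integrable q1 (wP j).1.1).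
  by apply: trajectory_causal xu xwj _ _ => s /andP[_]; exact: uw.
have l0 t : (0 <= (running_cost q F (u t) (trajectory x0 u t))%:E)%E.
  by rewrite lee_fin addr_ge0 ?pos_def_ge0// divr_ge0 ?powR_ge0// ltW.
have ml := running_cost_measurable q cF xu mu_.
have costu : (cost q F x0 u <= (W x0)%:E + e%:E)%E.
  apply: le_integral_ray => // j; have [[wq wj] _] := wP j.
  have iw := running_cost_integrable q1 cF
    (trajectoryP x0 (loc_Lq_integrable q1 wq)) (lexx 0) (wq.2 j%:R).
  have -> : (\int[mu]_(t in `[0%R, j%:R])
      (`|u t| `^ q / q + F (trajectory x0 u t))%:E = \int[mu]_(t in `[0%R, j%:R])
      (running_cost q F (w j t) (trajectory x0 (w j) t))%:E)%E.
    apply: eq_integral => t; rewrite inE/= in_itv/= => /andP[t0 tj].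
    by rewrite (uw j t tj) (xw j t (introT andP (conj t0 tj))).
  rewrite -[leLHS]fineK; last exact: integrable_fin_num.
  rewrite -EFinD lee_fin (le_trans _ (le_trans wj _))//.
    by rewrite lerDl pos_def_ge0.
  rewrite lerD2l; apply: ler_piMr; first exact: ltW.
  by rewrite ler_pdivrMr ?mul1r ?lerDr// ltr_wpDr.
apply: (le_trans _ costu); apply: ereal_inf_lbound; exists u => //.
(* Membership in [L^q] comes from the cost itself: [|u|^q] is at most [q] times the running cost,
   whose integral is finite by [costu]. *)
apply/controlP => //; split => //; apply/integrableP; split.
  apply/measurable_EFinP.
  by apply: (measurableT_comp (measurable_powR _)) => //; exact: measurableT_comp.
have iql : (\int[mu]_(t in `[0%R, +oo[) (q%:E *
    (running_cost q F (u t) (trajectory x0 u t))%:E) < +oo)%E.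
  rewrite ge0_integralZl//; last by rewrite lee_fin ltW.
  by rewrite lte_mul_pinfty ?lee_fin ?ltW// (le_lt_trans costu)// ltry.
apply: le_lt_trans iql; apply: ge0_le_integral => //.
- by apply/measurable_EFinP; apply: measurableT_comp => //;
  apply: (measurableT_comp (measurable_powR _)) => //; exact: measurableT_comp.
- exact: measurable_funeM.
move=> t _; rewrite -EFinM lee_fin ger0_norm ?powR_ge0// /running_cost mulrDr.
by rewrite mulrCA divff ?mulr1 ?gt_eqF// lerDl mulr_ge0 ?pos_def_ge0// ltW.
Qed.

Theorem proposition5p2 (R : realType) (n : nat) (q : R) (hq : 1 < q)
    (F : 'cV[R]_n.+1 -> R)
    (F_C1 : class_C1 F)
    (F_convex : convex_function [set: 'cV[R]_n.+1] F)
    (F_pos : pos_def F)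
    (W : 'cV[R]_n.+1 -> R)
    (W_C1 : class_C1 W)
    (W_pos : pos_def W) :
  ((forall x : 'cV[R]_n.+1,
      ((grad W x)^T *m (jordan_block R n.+1 *m x)) 0 0
      - (q - 1) / q * `|grad W x ord_max 0| `^ (q / (q - 1)) <= - F x) ->
    forall x : 'cV[R]_n.+1, (value q F x <= (W x)%:E)%E)
  /\
  ((forall x : 'cV[R]_n.+1,
      ((grad W x)^T *m (jordan_block R n.+1 *m x)) 0 0
      - (q - 1) / q * `|grad W x ord_max 0| `^ (q / (q - 1)) >= - F x) ->
    forall x : 'cV[R]_n.+1, ((W x)%:E <= value q F x)%E).
Proof.
by split; [exact: value_le_supersolution|exact: subsolution_le_value].
Qed.
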